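(* Let $n,k,t$ be positive integers with $k<n$ and $k\ge (n+3)/2$, and let $q$ be a prime power. If $\bar{B}$ is a minimal blocking set in $\mathrm{PG}(2,q)$ such that every point of $\bar{B}$ lies on at least $2$ tangent lines to $\bar{B}$, then there exists a minimal blocking set with respect to $(k-1)$-dimensional subspaces in $\mathrm{PG}(n-1,q^t)$ of size $|\bar{B}|q^{nt-kt-1}+\frac{q^{nt-kt-1}-1}{q-1}$.
   Context: A blocking set with respect to $j$-spaces in a projective space is a point set meeting every $j$-dimensional subspace; a blocking set in $\mathrm{PG}(2,q)$ is one with respect to lines. It is minimal if no proper subset has this property. A tangent line to $\bar B$ is a line meeting $\bar B$ in exactly one point. *)

(* Defs.v *)
From HB Require Import structures.
From mathcomp Require Import all_boot all_order all_algebra all_field.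
Set Implicit Arguments. Unset Strict Implicit. Unset Printing Implicit Defensive.
Import GRing.Theory.
Local Open Scope ring_scope.

(* Projective geometry PG(n-1, F) over a finite field F, modelled inside
   F^n (row vectors of length n).  A projective subspace of projective
   dimension d-1 is a d-dimensional vector subspace of F^n; we represent it
   canonically by the square matrix <<A>>%MS (its canonical row-space
   representative), so that distinct subspaces are distinct matrices. *)

Definition pg_sub (F : finFieldType) (n d : nat) : {set 'M[F]_n} :=
  [set A : 'M[F]_n | (\rank A == d) && (<<A>>%MS == A)].

Definition pg_points (F : finFieldType) (n : nat) : {set 'M[F]_n} :=
  pg_sub F n 1.

(* B is a set of points of PG(n-1,F) meeting every (j)-dimensional
   projective subspace, i.e. every (j+1)-dimensional vector subspace. *)
Definition blocking_set (F : finFieldType) (n j : nat) (B : {set 'M[F]_n}) :=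
  B \subset pg_points F n /\
  forall U, U \in pg_sub F n j.+1 -> exists2 P, P \in B & (P <= U)%MS.

Definition minimal_blocking_set (F : finFieldType) (n j : nat)
    (B : {set 'M[F]_n}) :=
  @blocking_set F n j B /\
  forall B' : {set 'M[F]_n}, B' \proper B -> ~ @blocking_set F n j B'.

Definition tangent_lines_through (F : finFieldType) (B : {set 'M[F]_3})
    (P : 'M[F]_3) : {set 'M[F]_3} :=
  [set L in pg_sub F 3 2 |
     (P <= L)%MS && (#|[set Q in B | (Q <= L)%MS]| == 1%N)].

(* Main.v *)
Require Import Defs.
From HB Require Import structures.
From mathcomp Require Import all_boot all_order all_algebra all_field.
From mathcomp Require Import all_fingroup all_solvable all_character zify.
Set Implicit Arguments. Unset Strict Implicit. Unset Printing Implicit Defensive.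
Import GRing.Theory.
Local Open Scope ring_scope.

(* Put d = n - k and embed F in K.  The F-space
     W = {(x, x^q, y, 0) : x in H, y in F^3},
   with H an F-hyperplane of K^d and x^q taken coordinatewise, lives in K^n since
   2 d + 3 <= n, has F-dimension d t + 2, and is scattered: two of its vectors
   that are proportional over K are so over F.  The cone in W with base Bbar
   and vertex {y = 0} therefore has as many points over K as over F.
   A K-subspace of dimension k meets W in F-dimension at least 2, so it meets the
   vertex or projects onto a subspace of F^3 containing a line, blocked by Bbar.
   For minimality, a point p of the cone lies on an F-line <p, w> of W that meets
   the cone only in p, and <p, w>_K meets W only in <p, w>_F; a counting argument
   extends <p, w>_K to a k-dimensional K-subspace without meeting more of W. *)

(** * Embedding GF(q) into GF(q^t) *)

Lemma finField_generator (F : finFieldType) :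
  exists a : F, forall x, x != 0 -> exists i : nat, x = a ^+ i.
Proof.
have /cyclicP[a aE] : cyclic [set: {unit F}] by apply: field_unit_group_cyclic.
exists (val a) => x nz_x.
have : finField_unit nz_x \in <[a]>%g by rewrite -aE inE.
by case/cycleP=> i /(congr1 val) xE; exists i; rewrite -FinRing.val_unitX -xE.
Qed.

(** Over [K] the polynomial X^|K| - X splits into linear factors, so a nonconstant divisor contains
    one of them. *)
Lemma root_of_dvdp_genPoly (K : finFieldType) (p : {poly K}) :
  (1 < size p)%N -> p %| 'X^#|K| - 'X -> exists b, root p b.
Proof.
rewrite finField_genPoly -big_enum => p_gt1 /dvdp_prod_XsubC[m].
case: mask => [|b s] pE; last first.
  by exists b; rewrite (eqp_root pE) root_prod_XsubC mem_head.
by move: p_gt1; rewrite (eqp_size pE) big_nil size_poly1.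
Qed.

(** If [a] generates [F], its minimal polynomial [m] over the prime field divides X^q - X, hence
    X^|K| - X, and so has a root [b] in [K]; the embedding sends g(a) to g(b). *)
Lemma finField_embedding (F K : finFieldType) t :
  #|K| = (#|F| ^ t)%N -> inhabited {rmorphism F -> K}.
Proof.
move=> cardK; have [p p_pr pF] := finPcharP F.
have cF := card_pprimeChar pF; rewrite -[#|_|]/#|F| in cF.
have pK : p \in [pchar K].
  by apply: (@card_finPcharP _ _ (logn p #|F| * t)); rewrite // expnM -cF.
pose L : splittingFieldType 'F_p := pPrimeCharType pF.
pose M : splittingFieldType 'F_p := pPrimeCharType pK.
have [a aP] := finField_generator F.
have /polyOver1P[m mE] := minPolyOver 1%AS (a : L).
have dvdXX (q : nat) s : ('X^q - 'X : {poly 'F_p}) %| 'X^(q ^ s) - 'X.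
  elim: s => [|s IHs]; first by rewrite expn0 expr1 subrr dvdp0.
  have -> : 'X^(q ^ s.+1) - 'X = ('X^(q ^ s.+1) - 'X^q) + ('X^q - 'X) :> {poly 'F_p}.
    by rewrite addrA subrK.
  (* X^(q^(s+1)) - X^q is a difference of q-th powers, hence a multiple of X^(q^s) - X. *)
  rewrite dvdp_add ?dvdpp // expnSr exprM.
  by rewrite (dvdp_trans IHs) // subrXX dvdp_mulIl.
have mdvd : m %| 'X^#|F| - 'X.
  rewrite -(dvdp_map (GRing.in_alg L)) -mE minPoly_dvdp //.
    by apply/polyOver1P; exists ('X^#|F| - 'X).
  by rewrite rmorphB /= map_polyXn map_polyX rootE !hornerE expf_card subrr.
have [b rb] : exists b : M, root (map_poly (GRing.in_alg M) m) b.
  apply: (@root_of_dvdp_genPoly K).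
    have -> : size (map_poly (GRing.in_alg M) m) = size m := size_map_poly _ _.
    rewrite -(size_map_poly (GRing.in_alg L)) -mE size_minPoly.
    exact: ltn0Sn.
  have : map_poly (GRing.in_alg M) m %| map_poly (GRing.in_alg M) ('X^#|K| - 'X).
    by rewrite dvdp_map cardK (dvdp_trans mdvd).
  by rewrite rmorphB /= map_polyXn map_polyX.
pose evL (g : {poly 'F_p}) : L := (map_poly (GRing.in_alg L) g).[a].
pose evM (g : {poly 'F_p}) : M := (map_poly (GRing.in_alg M) g).[b].
have evLB g h : evL (g - h) = evL g - evL h.
  by rewrite /evL rmorphB hornerD hornerN.
have evMB g h : evM (g - h) = evM g - evM h.
  by rewrite /evM rmorphB hornerD hornerN.
(* Well-definedness: polynomials agreeing at [a] differ by a multiple of [m], which vanishes at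
   [b]. *)
have evLM g h : evL g = evL h -> evM g = evM h.
  move=> /eqP; rewrite -subr_eq0 => /eqP gh; apply/eqP; rewrite -subr_eq0.
  have : m %| g - h.
    rewrite -(dvdp_map (GRing.in_alg L)) -mE minPoly_dvdp //.
      by apply/polyOver1P; exists (g - h).
    by rewrite rootE -[_.[_]]/(evL (g - h)) evLB gh.
  rewrite -(dvdp_map (GRing.in_alg M)) -evMB => /(dvdpP _ _) [k kE].
  by rewrite /evM kE hornerM (eqP rb) mulr0.
have /fin_all_exists[c cP] : forall x : F, exists g, evL g = x.
  move=> x; have [->|/aP[i ->]] := eqVneq x 0.
    by exists 0; rewrite /evL rmorph0 horner0.
  by exists 'X^i; rewrite /evL map_polyXn hornerXn.
(* The representatives [c] are chosen arbitrarily; [evLM] makes up for their failure to be additive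
   or multiplicative. *)
pose f (x : F) : K := evM (c x).
have fB : zmod_morphism f.
  move=> x y; rewrite -[f x - f y]/(evM (c x) - evM (c y)) -evMB.
  by apply: evLM; rewrite evLB !cP.
have fM : monoid_morphism f.
  split=> [|x y].
    transitivity (evM 1); last by rewrite /evM rmorph1 hornerC.
    by apply: evLM; rewrite cP /evL rmorph1 hornerC.
  transitivity (evM (c x * c y)); last by rewrite /evM rmorphM hornerM.
  apply: evLM; have -> : evL (c x * c y) = evL (c x) * evL (c y).
    by rewrite /evL rmorphM hornerM.
  by rewrite !cP.
pose fA := GRing.isZmodMorphism.Build _ _ f fB.
pose fX := GRing.isMonoidMorphism.Build _ _ f fM.
pose fR : {rmorphism F -> K} := HB.pack f fA fX.
by split.
Qed.

(** * Counting by fibres; projective points and their spanning vectors *)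

Lemma card_uniform_fibers (T U : finType) (g : T -> U) (A : {set T}) c :
  {in A, forall x, #|[set y in A | g y == g x]| = c} ->
  #|A| = (#|g @: A| * c)%N.
Proof.
move=> fibc; rewrite -sum1_card (partition_big_imset g) /= -sum_nat_const.
apply: eq_bigr => _ /imsetP[x Ax ->]; rewrite -(fibc x Ax) -sum1_card.
by apply: eq_bigl => y; rewrite inE.
Qed.

Lemma card_image_units (F : finFieldType) (T : finType) (g : F -> T) :
  injective g -> #|[set g a | a in [set~ 0]]| = #|F|.-1.
Proof. by move=> /card_imset ->; rewrite cardsC1. Qed.

Section Points.
Variables (F : finFieldType) (n : nat).
Implicit Types u v : 'rV[F]_n.

Lemma genmx_rV_eqP u v : v != 0 ->
  reflect (exists2 a, a != 0 & u = a *: v) (<<u>>%MS == <<v>>%MS).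
Proof.
move=> nz_v; apply: (iffP eqP) => [uv|[a nz_a ->]]; last first.
  exact/eq_genmx/eqmx_scale.
have /sub_rVP[a uE] : (u <= v)%MS by rewrite -(genmxE u) uv genmxE.
exists a => //; apply: contra_neq nz_v => a0.
by apply/eqP; rewrite -mxrank_eq0 -mxrank_gen -uv mxrank_gen uE a0 scale0r mxrank0.
Qed.

Lemma genmx_rV_point v : v != 0 -> <<v>>%MS \in pg_points F n.
Proof. by move=> nz_v; rewrite inE genmxE rank_rV nz_v genmx_id eqxx. Qed.

Lemma pg_pointP (P : 'M[F]_n) :
  reflect (exists2 v : 'rV[F]_n, v != 0 & P = <<v>>%MS) (P \in pg_points F n).
Proof.
apply: (iffP idP) => [|[v nz_v ->]]; last exact: genmx_rV_point.
rewrite inE => /andP[/eqP rP /eqP gP].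
have nz_v : nz_row P != 0 by rewrite nz_row_eq0 -mxrank_eq0 rP.
exists (nz_row P) => //; rewrite -{1}gP; apply/esym/eq_genmx.
apply/eqmxP; rewrite -(geq_leqif (mxrank_leqif_eq (nz_row_sub P))).
by rewrite rP rank_rV nz_v.
Qed.

Lemma mxrank_adds_rV m (U : 'M[F]_(m, n)) v :
  ~~ (v <= U)%MS -> \rank (U + v)%MS = (\rank U).+1.
Proof.
move=> vU; apply/eqP; rewrite eqn_leq; apply/andP; split.
  apply: leq_trans (mxrank_adds_leqif U v) _.
  by rewrite -[leqRHS]addn1 leq_add2l rank_leq_row.
have := mxrank_leqif_sup (addsmxSl U v) => /ltn_leqif ->.
by rewrite addsmx_sub submx_refl.
Qed.

(** The vectors spanning a given point are the q - 1 nonzero multiples of one of them. *)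
Lemma card_point_vectors (B : {set 'M[F]_n}) : B \subset pg_points F n ->
  #|[set v : 'rV[F]_n | (v != 0) && (<<v>>%MS \in B)]| = (#|B| * #|F|.-1)%N.
Proof.
move=> /subsetP Bpts; set A := [set v | _].
rewrite (@card_uniform_fibers _ _ (@genmx F 1 n) A #|F|.-1) => [|v].
  suff -> : (@genmx F 1 n) @: A = B by [].
  apply/setP=> P; apply/imsetP/idP => [[v]|BP].
    by rewrite inE => /andP[_ ?] ->.
  have /pg_pointP[v nz_v PE] := Bpts P BP.
  by exists v; rewrite // inE nz_v -PE.
rewrite inE => /andP[nz_v Bv].
rewrite -(@card_image_units F _ (fun a => a *: v)) => [|a b /eqP]; last first.
  by rewrite -subr_eq0 -scalerBl scalemx_eq0 (negPf nz_v) orbF subr_eq0 => /eqP.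
apply: eq_card => u; rewrite !inE; apply/andP/imsetP => [[_ uv]|[a]].
  by have [a nz_a ->] := genmx_rV_eqP _ nz_v uv; exists a; rewrite ?inE.
rewrite !inE => nz_a ->; rewrite scalemx_eq0 negb_or nz_a nz_v.
have /eqP avE : <<a *: v>>%MS == <<v>>%MS by apply/genmx_rV_eqP => //; exists a.
by rewrite avE Bv eqxx.
Qed.

End Points.

(** * Enlarging a subspace without meeting more of an additive group *)

Section Avoiding.
Variables (K : finFieldType) (N d : nat) (W : {group 'rV[K]_N}).

(* [v] must avoid the vectors [l *: s] with [l != 0] and [s] in [W + U]; there
   are at most [(#|K| - 1) * #|K| ^ (d + \rank U) < #|K| ^ N] of them. *)
Lemma extend_avoiding_step m (U : 'M[K]_(m, N)) :
  (#|W| <= #|K| ^ d * #|W :&: rowg U|)%N -> (\rank U + d < N)%N ->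
  exists2 v : 'rV[K]_N, ~~ (v <= U)%MS & W :&: rowg (U + v)%MS = W :&: rowg U.
Proof.
move=> cardW ltUN; pose S := (W * rowg U)%g.
(* The product formula gives |W + U| |W :&: U| = |W| |U|, and |W| is at most |K|^d |W :&: U|. *)
have cardS : (#|S| <= #|K| ^ (d + \rank U))%N.
  have WU_gt0 : (0 < #|W :&: rowg U|)%N by rewrite cardG_gt0.
  rewrite -(leq_pmul2r WU_gt0) -mul_cardG card_rowg expnD mulnAC.
  by rewrite leq_mul2r cardW orbT.
have K_gt1 : (1 < #|K|)%N := finNzRing_gt1 K.
pose X := [set l *: s | l in [set~ (0 : K)], s in S].
have : (#|X| < #|[set: 'rV[K]_N]|)%N.
  rewrite /X curry_imset2X; apply: leq_ltn_trans (leq_imset_card _ _) _.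
  rewrite cardsX cardsC1 cardsT card_mx mul1n.
  apply: (@leq_trans (#|K| ^ (d + \rank U).+1)); last first.
    by rewrite leq_exp2l // addnC.
  rewrite expnS; case: #|K| K_gt1 cardS => // k' _ cardS.
  by rewrite -[(k'.+1).-1]/k' (leq_ltn_trans (leq_mul (leqnn k') cardS)) //
     ltn_pmul2r ?expn_gt0.
move=> ltX; have /subsetPn[v _ vX] : ~~ ([set: 'rV[K]_N] \subset X).
  by apply: contraL ltX => /subset_leq_card; rewrite -leqNgt.
have XP l w u : l != 0 -> w \in W -> (u <= U)%MS -> v != l *: (w + u).
  move=> nz_l Ww Uu; apply: contraNneq vX => ->.
  by apply/imset2P; exists l (w + u); rewrite ?inE // mem_mulg ?mem_rowg.
exists v; first by apply/negP=> Uv; have := XP 1 0 v (oner_neq0 _) (group1 W) Uv;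
  rewrite scale1r add0r eqxx.
apply/setP=> w; rewrite !inE; have [Ww|//] := boolP (w \in W); apply/idP/idP => [|Uw].
  case/sub_addsmxP=> -[a b] /=; rewrite (mx11_scalar b) mul_scalar_mx => wE.
  have [b0|nz_b] := eqVneq (b 0 0) 0.
    by rewrite wE b0 scale0r addr0 submxMl.
  (* A vector w = a U + b v of [W] with b nonzero would make v = b^-1 (w - a U) one of the avoided
     vectors. *)
  have := XP (b 0 0)^-1 w (- (a *m U)); rewrite invr_eq0 nz_b eqmx_opp submxMl Ww.
  case/(_ isT isT isT)/eqP; rewrite wE.
  by rewrite addrAC subrr add0r scalerA mulVf // scale1r.
exact: submx_trans Uw (addsmxSl _ _).
Qed.

(** Vectors are added one at a time up to rank N - d; each step leaves [W :&: rowg U] unchanged, so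
    the size hypothesis persists. *)
Lemma extend_avoiding m (U : 'M[K]_(m, N)) :
  (#|W| <= #|K| ^ d * #|W :&: rowg U|)%N -> (\rank U + d <= N)%N ->
  exists U' : 'M[K]_N,
    [/\ \rank U' = (N - d)%N, (U <= U')%MS & W :&: rowg U' = W :&: rowg U].
Proof.
have [e] := ubnP (N - d - \rank U)%N; elim: e => // e IHe in m U * => lte cardW.
rewrite leq_eqVlt => /predU1P[rU|ltU].
  exists <<U>>%MS; rewrite !genmxE (eq_rowg (genmxE U)); split=> //.
  by apply/eqP; rewrite -(eqn_add2r d) rU subnK // -rU leq_addl.
have [v vU WE] := extend_avoiding_step cardW ltU.
have rUv := mxrank_adds_rV vU.
have [|||U' [rU' sU' WU']] := IHe _ (U + v)%MS.
- by rewrite rUv subnS -ltnS (leq_trans _ lte) // ltnS prednK // !subn_gt0 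
    ltn_subRL addnC.
- by rewrite WE.
- by rewrite rUv.
by exists U'; rewrite rU' WU' WE (submx_trans (addsmxSl U v)).
Qed.

End Avoiding.

(** * The F-space W and its scatteredness *)

Section LinearSet.
Variables (F K : finFieldType) (f : {rmorphism F -> K}) (d r : nat).
Local Notation q := #|F|.
Implicit Types (a b : F) (x : 'rV[K]_d.+1) (y : 'rV[F]_3).

Lemma expr_cardD (z z' : K) : (z + z') ^+ q = z ^+ q + z' ^+ q.
Proof.
have [p p_pr pF] := finPcharP F; have pK : p \in [pchar K] by rewrite (fmorph_pchar f).
rewrite exprDn_pchar // (card_pprimeChar pF) pnatX; apply/orP; left.
by rewrite pnatE.
Qed.

(** X^q - X is the product of the X - a with a in [F]. *)
Lemma expr_card_fixP (z : K) : reflect (exists a, z = f a) (z ^+ q == z).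
Proof.
apply: (iffP eqP) => [zq|[a ->]]; last by rewrite -rmorphXn expf_card.
have : (map_poly f ('X^q - 'X)).[z] == 0.
  by rewrite rmorphB /= map_polyXn map_polyX !hornerE zq subrr.
rewrite finField_genPoly rmorph_prod horner_prod => /prodf_eq0[a _].
by rewrite rmorphB /= map_polyX map_polyC !hornerE subr_eq0 => /eqP; exists a.
Qed.

Definition frob x : 'rV[K]_d.+1 := map_mx (fun z => z ^+ q) x.

Lemma frobD x x' : frob (x + x') = frob x + frob x'.
Proof. by apply/rowP=> j; rewrite !mxE expr_cardD. Qed.

Lemma frobZ a x : frob (f a *: x) = f a *: frob x.
Proof. by apply/rowP=> j; rewrite !mxE exprMn -rmorphXn expf_card. Qed.

Lemma frob0 : frob 0 = 0.
Proof. by rewrite -(scale0r (0 : 'rV_d.+1)) -(rmorph0 f) frobZ rmorph0 !scale0r. Qed.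

(* The additive map [z |-> z ^ q - z] has kernel GF(q), so it maps K onto an
   F-hyperplane. *)
Definition artin x : 'rV[K]_d.+1 :=
  \row_j (if j == 0 then x 0 j ^+ q - x 0 j else x 0 j).

Lemma artinD x x' : artin (x + x') = artin x + artin x'.
Proof.
by apply/rowP=> j; rewrite !mxE; case: eqP => // _; rewrite expr_cardD opprD addrACA.
Qed.

Lemma artinZ a x : artin (f a *: x) = f a *: artin x.
Proof.
apply/rowP=> j; rewrite !mxE; case: eqP => // _.
by rewrite exprMn -rmorphXn expf_card mulrBr.
Qed.

Lemma artin_eq0P x : reflect (exists a, x = f a *: delta_mx 0 0) (artin x == 0).
Proof.
apply: (iffP eqP) => [x0|[a ->]].
  have /eqP := congr1 (fun v : 'rV__ => v 0 0) x0; rewrite !mxE eqxx subr_eq0.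
  case/expr_card_fixP=> a xa; exists a; apply/rowP=> j; rewrite !mxE /= eq_sym.
  case: eqP => [<-|/eqP nz_j]; first by rewrite mulr1.
  have := congr1 (fun v : 'rV__ => v 0 j) x0; rewrite !mxE eq_sym (negPf nz_j) => ->.
  by rewrite mulr0.
rewrite artinZ; apply/rowP=> j; rewrite !mxE /=; case: eqP => _; last by rewrite mulr0.
by rewrite expr1n subrr mulr0.
Qed.

Definition hyper : {set 'rV[K]_d.+1} := artin @: setT.

Lemma hyperD x x' : x \in hyper -> x' \in hyper -> x + x' \in hyper.
Proof.
by case/imsetP=> z _ -> /imsetP[z' _ ->]; rewrite -artinD imset_f.
Qed.

Lemma hyperZ a x : x \in hyper -> f a *: x \in hyper.
Proof. by case/imsetP=> z _ ->; rewrite -artinZ imset_f. Qed.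

Lemma hyper0 : 0 \in hyper.
Proof. by rewrite -(scale0r (artin 0)) -(rmorph0 f) hyperZ // imset_f. Qed.

(** The fibres of [artin] are cosets of its kernel, the q F-multiples of the first basis vector. *)
Lemma card_hyper : (#|hyper| * q = #|K| ^ d.+1)%N.
Proof.
have <- : #|[set: 'rV[K]_d.+1]| = (#|K| ^ d.+1)%N by rewrite cardsT card_mx mul1n.
apply/esym/card_uniform_fibers => x _.
pose g a := x + f a *: delta_mx 0 0 : 'rV[K]_d.+1.
have g_inj : injective g.
  move=> a b /addrI/rowP/(_ 0); rewrite !mxE !mulr1; exact: fmorph_inj.
rewrite -[RHS]cardsT -(card_imset _ g_inj); apply: eq_card => z; rewrite !inE.
have -> : (artin z == artin x) = (artin (z - x) == 0).
  by rewrite -[in LHS](subrK x z) artinD -[X in _ == X]add0r (inj_eq (addIr _)).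
apply/artin_eq0P/imsetP => [[a zE]|[a _ ->]]; exists a => //.
  by rewrite /g -zE addrC subrK.
by rewrite /g addrC addKr.
Qed.

Local Notation N := (d.+1 + (d.+1 + (3 + r)))%N.

(** The block [frob x] is there to force K-scalars between such vectors into [F]; the last block
    pads the length to N. The d of the introductory comment is [d.+1] here. *)
Definition emb x y : 'rV[K]_N :=
  row_mx x (row_mx (frob x) (row_mx (map_mx f y) 0)).

Lemma embD x y x' y' : emb (x + x') (y + y') = emb x y + emb x' y'.
Proof. by rewrite /emb frobD map_mxD !add_row_mx addr0. Qed.

Lemma embZ a x y : emb (f a *: x) (a *: y) = f a *: emb x y.
Proof. by rewrite /emb frobZ map_mxZ !scale_row_mx scaler0. Qed.

Lemma emb_comb (al be : K) x y x1 y1 x2 y2 :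
  emb x y = al *: emb x1 y1 + be *: emb x2 y2 ->
  [/\ x = al *: x1 + be *: x2, frob x = al *: frob x1 + be *: frob x2 &
      map_mx f y = al *: map_mx f y1 + be *: map_mx f y2].
Proof.
rewrite /emb !scale_row_mx !add_row_mx.
by case/eq_row_mx=> ? /eq_row_mx[? /eq_row_mx[? _]].
Qed.

Lemma emb_comb0 (al be : K) x y x1 y1 y2 :
  emb x y = al *: emb x1 y1 + be *: emb 0 y2 ->
  [/\ x = al *: x1, frob x = al *: frob x1 &
      map_mx f y = al *: map_mx f y1 + be *: map_mx f y2].
Proof. by case/emb_comb; rewrite frob0 !scaler0 !addr0. Qed.

Lemma map_rV_inj : injective (map_mx f : 'rV[F]_3 -> 'rV[K]_3).
Proof. exact: map_mx_inj. Qed.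

Lemma emb_inj x y x' y' : emb x y = emb x' y' -> (x, y) = (x', y').
Proof.
move=> eq_e; have := @emb_comb 1 0 x y x' y' 0 0.
rewrite !scale1r !scale0r !addr0 => /(_ eq_e)[-> _ /map_rV_inj-> //].
Qed.

Lemma emb0 : emb 0 0 = 0.
Proof. by apply: (addrI (emb 0 0)); rewrite -embD !addr0. Qed.

Lemma emb_eq0 x y : (emb x y == 0) = (x == 0) && (y == 0).
Proof.
apply/eqP/andP=> [|[/eqP-> /eqP->]]; last exact: emb0.
by rewrite -emb0 => /emb_inj[-> ->].
Qed.

(** At a nonzero coordinate of x the two equations give al^q = al. *)
Lemma frob_scalar (al : K) x x' :
  x != 0 -> x' = al *: x -> frob x' = al *: frob x -> exists a, al = f a.
Proof.
move=> /rV0Pn[j nz_xj] -> /rowP/(_ j); rewrite !mxE exprMn => /mulIf alq.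
by apply/expr_card_fixP/eqP/alq; rewrite expf_neq0.
Qed.

Lemma map_scalar (al : K) y y' :
  y != 0 -> map_mx f y' = al *: map_mx f y -> exists a, al = f a.
Proof.
move=> /rV0Pn[j nz_yj] /rowP/(_ j); rewrite !mxE => yE.
exists (y' 0 j / y 0 j); rewrite fmorph_div yE mulfK //.
by rewrite fmorph_eq0.
Qed.

(** Scatteredness: one of the blocks x, y is nonzero, and either one forces the scalar into [F]. *)
Lemma emb_scalar (al : K) x y x' y' :
  emb x y != 0 -> emb x' y' = al *: emb x y -> exists a, al = f a.
Proof.
rewrite emb_eq0 negb_and => nz_xy eq_e; have := @emb_comb al 0 x' y' x y 0 0.
rewrite !scale0r !addr0 => /(_ eq_e)[xE fE yE].
by case/orP: nz_xy => [/frob_scalar|/map_scalar]; [apply|apply]; eauto.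
Qed.

Definition linset : {set 'rV[K]_N} :=
  [set emb u.1 u.2 | u in setX hyper [set: 'rV[F]_3]].

Lemma linsetP v :
  reflect (exists x y, x \in hyper /\ v = emb x y) (v \in linset).
Proof.
apply: (iffP imsetP) => [[[x y]]|[x [y [Hx ->]]]].
  by rewrite !inE andbT => Hx ->; exists x, y.
by exists (x, y); rewrite // !inE Hx.
Qed.

Fact linset_group_set : group_set linset.
Proof.
apply/group_setP; split.
  by apply/linsetP; exists 0, 0; rewrite hyper0 emb0.
move=> _ _ /linsetP[x [y [Hx ->]]] /linsetP[x' [y' [Hx' ->]]].
by apply/linsetP; exists (x + x'), (y + y'); rewrite hyperD // embD.
Qed.
Canonical linset_group := Group linset_group_set.

(** H loses one F-dimension against K^(d+1) and y adds three; the surplus of two is what a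
    K-subspace of codimension d+1 must still meet. *)
Lemma card_linset : (#|linset| = #|K| ^ d.+1 * q ^ 2)%N.
Proof.
rewrite card_imset => [|[x y] [x' y'] /emb_inj //].
by rewrite cardsX cardsT card_mx mul1n -card_hyper -mulnA -expnS.
Qed.

End LinearSet.

(** * Independent pairs and tangent directions over F *)

(** A subspace of rank at most 1 has at most q vectors, so it cannot contain [Y]; this is applied to
    the zero space and then to <y1>. *)
Lemma independent_pair (F : finFieldType) n (Y : {set 'rV[F]_n}) :
  (#|F| ^ 2 <= #|Y|)%N ->
  exists y1 y2, [/\ y1 \in Y, y2 \in Y & \rank (y1 + y2)%MS = 2].
Proof.
have F_gt1 := finNzRing_gt1 F => cardY.
have outside m (U : 'M[F]_(m, n)) : (\rank U < 2)%N ->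
    exists2 y, y \in Y & ~~ (y <= U)%MS.
  move=> rU; have /subsetPn[y Yy] : ~~ (Y \subset rowg U).
    apply: contraL cardY => /subset_leq_card leY; rewrite -ltnNge.
    by rewrite (leq_ltn_trans leY) // card_rowg ltn_exp2l.
  by rewrite inE; exists y.
have [|y1 Y1 y1N] := outside _ (0 : 'M_n); first by rewrite mxrank0.
have nz_y1 : y1 != 0 by apply: contraNneq y1N => ->; rewrite sub0mx.
have [|y2 Y2 y2N] := outside _ y1; first by rewrite rank_rV nz_y1.
by exists y1, y2; rewrite Y1 Y2 mxrank_adds_rV // rank_rV nz_y1.
Qed.

Lemma sub_adds_rVP (F : fieldType) n (u v w : 'rV[F]_n) :
  reflect (exists a b, w = a *: u + b *: v) (w <= u + v)%MS.
Proof.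
apply: (iffP sub_addsmxP) => [[[A B] /= ->]|[a [b ->]]].
  exists (A 0 0), (B 0 0).
  by rewrite [in LHS](mx11_scalar A) [in LHS](mx11_scalar B) !mul_scalar_mx.
by exists (a%:M, b%:M); rewrite /= !mul_scalar_mx.
Qed.

(* For [y0 = 0] the point <y1> lies off [Bbar]; otherwise the line <y0, y1> is
   tangent to [Bbar] at <y0>. *)
Lemma tangent_direction (F : finFieldType) (Bbar : {set 'M[F]_3}) (y0 : 'rV[F]_3) :
  blocking_set 1 Bbar ->
  (forall P, P \in Bbar -> (0 < #|tangent_lines_through Bbar P|)%N) ->
  (y0 == 0) || (<<y0>>%MS \in Bbar) ->
  exists y1, forall a b, let y := a *: y0 + b *: y1 in
    (y == 0) || (<<y>>%MS \in Bbar) -> b = 0.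
Proof.
move=> [/subsetP subB blockB] tanB y0B.
(* When y0 = 0 any point of [Bbar] serves as P; the blocked line [pid_mx 2] supplies one. *)
have [P [BP y0P]] : exists P, P \in Bbar /\ (y0 <= P)%MS.
  have [->|nz_y0] := eqVneq y0 0; last first.
    by exists <<y0>>%MS; rewrite genmxE submx_refl; move: y0B; rewrite (negPf nz_y0).
  have [|P BP _] := blockB <<pid_mx 2 : 'M[F]_3>>%MS.
    by rewrite inE mxrank_gen rank_pid_mx // genmx_id !eqxx.
  by exists P; rewrite BP sub0mx.
have /card_gt0P[L] := tanB P BP; rewrite !inE => /and3P[/andP[/eqP rL _] PL /cards1P[Q QE]].
have BL R : R \in Bbar -> (R <= L)%MS -> R = P.
  move=> BR RL; have: P \in [set Q] by rewrite -QE inE BP.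
  have: R \in [set Q] by rewrite -QE inE BR.
  by rewrite !inE => /eqP-> /eqP->.
have /row_subPn[i LiP] : ~~ (L <= P)%MS.
  apply/negP=> /mxrankS; rewrite rL.
  suff -> : \rank P = 1%N by [].
  by have /pg_pointP[v nz_v ->] := subB P BP; rewrite mxrank_gen rank_rV nz_v.
(* The direction y1 is a row of the tangent line L outside P. A combination y that is 0 or in [Bbar]
   lies in P by tangency, and b nonzero would then put y1 in P. *)
exists (row i L) => a b y yB; apply: contraNeq LiP => nz_b.
have yP : (y <= P)%MS.
  case/orP: yB => [/eqP->|yB]; first exact: sub0mx.
  rewrite -(BL _ yB) ?genmxE // addmx_sub ?scalemx_sub ?row_sub //.
  exact: submx_trans PL.
have -> : row i L = b^-1 *: (y - a *: y0).
  by rewrite /y addrC addKr scalerA mulVf // scale1r.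
by rewrite scalemx_sub // addmx_sub // eqmx_opp scalemx_sub.
Qed.

(** * The cone: size, blocking property and minimality *)

Section Cone.
Variables (F K : finFieldType) (f : {rmorphism F -> K}) (d r : nat).
Variable Bbar : {set 'M[F]_3}.
Local Notation q := #|F|.
Local Notation N := (d.+1 + (d.+1 + (3 + r)))%N.
Local Notation emb := (emb f r).
Implicit Types (a b : F) (x : 'rV[K]_d.+1) (y : 'rV[F]_3).

(** Kept as a set of F-coordinate pairs rather than of points, so that F-linear combinations can be
    formed; the pairs with y = 0 make up the vertex. *)
Definition cone : {set 'rV[K]_d.+1 * 'rV[F]_3} :=
  [set u | [&& u.1 \in hyper F K d, u != 0 & (u.2 == 0) || (<<u.2>>%MS \in Bbar)]].

Definition cone_points : {set 'M[K]_N} := [set <<emb u.1 u.2>>%MS | u in cone].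

Lemma cone_emb_neq0 u : u \in cone -> emb u.1 u.2 != 0.
Proof.
rewrite inE emb_eq0 => /and3P[_ nz_u _]; apply: contra nz_u.
by case: u => x y /= /andP[/eqP-> /eqP->].
Qed.

Lemma cone_points_sub : cone_points \subset pg_points K N.
Proof.
by apply/subsetP=> _ /imsetP[u Cu ->]; apply/genmx_rV_point/cone_emb_neq0.
Qed.

Lemma coneZ a u : a != 0 -> u \in cone -> (f a *: u.1, a *: u.2) \in cone.
Proof.
case: u => x y nz_a; rewrite !inE /= => /and3P[Hx nz_u uB]; rewrite hyperZ //=.
have -> : <<a *: y>>%MS = <<y>>%MS by apply/eq_genmx/eqmx_scale.
rewrite scalemx_eq0 (negPf nz_a) uB andbT; apply: contra nz_u.
case/eqP=> /eqP; rewrite scalemx_eq0 fmorph_eq0 (negPf nz_a) => /eqP-> /eqP.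
by rewrite scalemx_eq0 (negPf nz_a) => /eqP->.
Qed.

Lemma card_cone_points : #|cone| = (#|cone_points| * q.-1)%N.
Proof.
apply: card_uniform_fibers => u Cu.
have nz_u := cone_emb_neq0 Cu.
pose g a := (f a *: u.1, a *: u.2).
rewrite -(@card_image_units F _ g) => [|a b gE]; last first.
  apply: (fmorph_inj f); have : f a *: emb u.1 u.2 = f b *: emb u.1 u.2.
    by case: gE => gE1 gE2; rewrite -!embZ gE1 gE2.
  move=> /eqP; rewrite -subr_eq0 -scalerBl scalemx_eq0 (negPf nz_u) orbF.
  by rewrite subr_eq0 => /eqP.
apply: eq_card => v; rewrite inE; apply/andP/imsetP => [[Cv uv]|[a]].
  have [al nz_al vE] := genmx_rV_eqP _ nz_u uv.
  have [a aE] := emb_scalar nz_u vE; exists a.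
    by rewrite !inE; apply: contra_neq nz_al => a0; rewrite aE a0 rmorph0.
  by move: vE; rewrite aE -embZ => /emb_inj; case: v {Cv uv}.
rewrite in_setC1 => nz_a ->; split; first exact: coneZ.
by rewrite embZ; apply/eqP/eq_genmx/eqmx_scale; rewrite fmorph_eq0.
Qed.

Hypothesis Bbar_sub : Bbar \subset pg_points F 3.

(** The vertex contributes the nonzero vectors of H; over each of the |Bbar| (q - 1) vectors of the
    base, x runs through all of H. *)
Lemma card_cone : #|cone| = (#|hyper F K d|.-1 + #|hyper F K d| * (#|Bbar| * q.-1))%N.
Proof.
pose vertex := setX (hyper F K d :\ 0) [set (0 : 'rV[F]_3)].
pose V := [set v : 'rV[F]_3 | (v != 0) && (<<v>>%MS \in Bbar)].
have -> : cone = vertex :|: setX (hyper F K d) V.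
  apply/setP=> -[x y]; rewrite !inE /=.
  have -> : ((x, y) != 0) = ~~ ((x == 0) && (y == 0)) by [].
  by case: (y == 0); case: (x == 0); case: (x \in _); case: (_ \in Bbar).
rewrite cardsU disjoint_setI0 ?cards0 ?subn0; last first.
  apply/pred0P=> -[x y]; rewrite /= !inE /=.
  by case: (y == 0); rewrite ?andbF.
by rewrite !cardsX cards1 muln1 card_point_vectors // (cardsD1 0 (hyper _ _ _)) hyper0.
Qed.

Lemma card_cone_points_eq :
  #|cone_points| = (#|Bbar| * #|hyper F K d| + (#|hyper F K d| - 1) %/ (q - 1))%N.
Proof.
have q1_gt0 : (0 < q - 1)%N by rewrite subn_gt0 finNzRing_gt1.
apply/eqP; rewrite -(eqn_pmul2r q1_gt0) {1}subn1 -card_cone_points card_cone.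
(* That q - 1 divides |H| - 1 is read off from the count: it divides both |cone| and the term with
   [Bbar]. *)
rewrite mulnDl divnK ?subn1; last first.
  rewrite -(dvdn_addl _ (n := #|hyper F K d| * (#|Bbar| * q.-1))) ?mulnA ?dvdn_mull //.
  by rewrite -mulnA -card_cone card_cone_points dvdn_mull.
by rewrite addnC mulnCA mulnA.
Qed.

Lemma cone_points_blocking (k : nat) :
  k = (N - d.+1)%N -> blocking_set 1 Bbar -> blocking_set k.-1 cone_points.
Proof.
move=> kE [_ blockB]; split=> [|U]; first exact: cone_points_sub.
have k_gt0 : (0 < k)%N by rewrite kE addKn.
rewrite prednK // inE => /andP[/eqP rU _].
pose A := [set u : 'rV[K]_d.+1 * 'rV[F]_3 |
            (u.1 \in hyper F K d) && (emb u.1 u.2 <= U)%MS].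
have AZD a b u v : u \in A -> v \in A ->
    (f a *: u.1 + f b *: v.1, a *: u.2 + b *: v.2) \in A.
  rewrite !inE => /andP[Hu Uu] /andP[Hv Uv] /=.
  by rewrite embD !embZ addmx_sub ?scalemx_sub // hyperD ?hyperZ.
(* [A] parametrises the intersection of W and U: here |W| |U| = |K|^N q^2, while |W + U| is at most
   |K|^N. *)
have cardA : (q ^ 2 <= #|A|)%N.
  have WUA : linset f d r :&: rowg U \subset [set emb u.1 u.2 | u in A].
    apply/subsetP=> v; rewrite inE => /andP[/linsetP[x [y [Hx ->]]]].
    by rewrite inE => Uv; apply/imsetP; exists (x, y); rewrite // inE Hx.
  apply: leq_trans (leq_imset_card (fun u => emb u.1 u.2) _).
  apply: leq_trans (subset_leq_card WUA).
  have K_gt0 : (0 < #|K| ^ N)%N by rewrite expn_gt0 (ltnW (finNzRing_gt1 K)).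
  rewrite -(leq_pmul2l K_gt0).
  have <- : (#|linset f d r| * #|rowg U| = #|K| ^ N * q ^ 2)%N.
    rewrite card_linset card_rowg rU kE mulnAC -expnD subnKC //.
    exact: leq_addr.
  rewrite mul_cardG leq_mul2r; apply/orP; right.
  by apply: leq_trans (max_card _) _; rewrite card_mx mul1n.
have inB u : u \in A -> u != 0 -> (u.2 == 0) || (<<u.2>>%MS \in Bbar) ->
    exists2 P, P \in cone_points & (P <= U)%MS.
  rewrite inE => /andP[Hu Uu] nz_u uB; exists <<emb u.1 u.2>>%MS.
    by apply/imsetP; exists u; rewrite // inE Hu nz_u.
  by rewrite genmxE.
(* A nonzero vector of [A] with y = 0 is a vertex point in U. Otherwise projection to y is injective
   on [A], leaving at least q^2 vectors in F^3, two of them independent. *)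
have [/existsP[u /and3P[Au nz_u u0]]|noV] :=
    boolP [exists u, [&& u \in A, u != 0 & u.2 == 0]].
  by apply: inB Au nz_u _; rewrite u0.
have sndI : {in A &, injective snd}.
  move=> u v Au Av uv; apply/eqP; rewrite -subr_eq0.
  apply: contraNT noV => nz_uv; apply/existsP; exists (u - v); rewrite nz_uv.
  have := AZD 1 (- 1) u v Au Av; rewrite rmorphN rmorph1 !scaleN1r !scale1r => ->.
  by rewrite /= uv subrr.
have [|_ [_ [/imsetP[u1 A1 ->] /imsetP[u2 A2 ->] r12]]] :=
  @independent_pair F 3 (snd @: A); first by rewrite card_in_imset.
have [|P BP] := blockB <<(u1.2 + u2.2)%MS>>%MS.
  by rewrite inE mxrank_gen r12 genmx_id !eqxx.
have /pg_pointP[v nz_v PE] := subsetP Bbar_sub P BP.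
rewrite PE !genmxE => /sub_adds_rVP[a [b vE]].
apply: (inB _ (AZD a b _ _ A1 A2)) => /=; last by rewrite -vE -PE BP orbT.
by apply: contra_neq nz_v => -[_]; rewrite vE.
Qed.

Lemma cone_points_essential (k : nat) u : k = (N - d.+1)%N ->
    blocking_set 1 Bbar ->
    (forall P, P \in Bbar -> (0 < #|tangent_lines_through Bbar P|)%N) ->
    u \in cone ->
  exists2 U, U \in pg_sub K N k &
    forall P, P \in cone_points -> (P <= U)%MS -> P = <<emb u.1 u.2>>%MS.
Proof.
case: u => x0 y0 kE blockB tanB Cu; have nz_p := cone_emb_neq0 Cu.
move: (Cu); rewrite inE => /= /and3P[Hx0 nz_u y0B].
have [y1 y1P] := tangent_direction blockB tanB y0B.
(* Adding [w] changes only the y-block, and by the choice of y1 no F-combination of p and w with a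
   nonzero coefficient on w is in the cone. *)
pose p := emb x0 y0; pose w := emb (0 : 'rV[K]_d.+1) y1.
have nz_y1 : y1 != 0.
  apply: contra_neq (oner_neq0 F) => y10; apply: (y1P 0).
  by rewrite y10 scaler0 scale0r addr0 eqxx.
have indep a : y1 != a *: y0.
  apply: contra_neq (oner_neq0 F) => y1E; apply: (y1P (- a)).
  by rewrite y1E scale1r scaleNr addNr eqxx.
have fw a b : f a *: p + f b *: w = emb (f a *: x0) (a *: y0 + b *: y1).
  by rewrite -!embZ -embD scaler0 addr0.
have pw_inj : injective (fun ab : F * F => f ab.1 *: p + f ab.2 *: w).
  case=> a b [a' b'] /= /eqP; rewrite -subr_eq0 opprD addrACA -!scalerBl -!rmorphB.
  rewrite fw emb_eq0 => /andP[x00 y00].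
  have b0 : b - b' = 0 by apply: (y1P (a - a')); rewrite y00.
  have : f (a - a') *: p == 0.
    by rewrite -embZ emb_eq0 x00; move: y00; rewrite b0 scale0r addr0.
  rewrite scalemx_eq0 (negPf nz_p) orbF fmorph_eq0 subr_eq0 => /eqP->.
  by move/eqP: b0; rewrite subr_eq0 => /eqP->.
(* The q^2 F-combinations of p and w lie in W, which suffices since |W| = |K|^(d+1) q^2. *)
have cardW : (#|linset f d r| <= #|K| ^ d.+1 * #|linset f d r :&: rowg (p + w)%MS|)%N.
  rewrite card_linset leq_mul2l; apply/orP; right.
  rewrite -[(q ^ 2)%N]mulnn -card_prod -(card_imset _ pw_inj).
  apply/subset_leq_card/subsetP=> _ /imsetP[[a b] _ ->]; rewrite inE mem_rowg.
  rewrite addmx_sub_adds ?scalemx_sub // andbT fw.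
  by apply/linsetP; exists (f a *: x0), (a *: y0 + b *: y1); rewrite hyperZ.
have [|U' [rU' sU' WU']] := extend_avoiding cardW.
  rewrite addnC leq_add2l; apply: leq_trans (mxrank_adds_leqif p w) _.
  apply: leq_trans (leq_add (rank_leq_row p) (rank_leq_row w)) _.
  by lia.
exists <<U'>>%MS; first by rewrite inE mxrank_gen rU' kE genmx_id !eqxx.
move=> _ /imsetP[[x y] Cxy ->] /=; rewrite !genmxE => xyU'.
have nz_xy := cone_emb_neq0 Cxy; move: (Cxy); rewrite inE => /= /and3P[Hx _ yB].
have : emb x y \in linset f d r :&: rowg U'.
  by rewrite inE mem_rowg xyU' andbT; apply/linsetP; exists x, y.
rewrite WU' inE mem_rowg => /andP[_ /sub_adds_rVP[al [be eE]]].
(* The K-coefficients lie in [F]. If y0 = 0 then x0 is nonzero, the Frobenius block settles al, and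
   then y1 settles be. Otherwise y is an F-combination of y0 and y1, and their independence makes
   its coefficients unique even over [K]. *)
have [a [b [aE bE]]] : exists a b, al = f a /\ be = f b.
  have [xE fxE yE] := emb_comb0 eE.
  have [y00|nz_y0] := eqVneq y0 0.
    have [|a aE] := frob_scalar f _ xE fxE.
      by apply: contra_neq nz_u => ->; rewrite y00.
    move: yE; rewrite y00 map_mx0 scaler0 add0r => /(map_scalar nz_y1)[b bE].
    by exists a, b.
  have : (map_mx f y <= map_mx f y0 + map_mx f y1)%MS.
    by apply/sub_adds_rVP; exists al, be.
  rewrite -map_addsmx map_submx => /sub_adds_rVP[a [b yE']]; exists a, b.
  move: yE; rewrite yE' map_mxD !map_mxZ => /eqP.
  rewrite -subr_eq0 opprD addrACA -!scalerBl addr_eq0 -scaleNr opprB => /eqP yE.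
  have be_b : be = f b.
    apply/eqP; rewrite -subr_eq0; apply/negPn/negP=> nz_be.
    have : (map_mx f y1 <= map_mx f y0)%MS.
      rewrite -(eqmx_scale _ nz_be) -yE; exact: scalemx_sub.
    by rewrite map_submx => /sub_rVP[c /eqP]; apply/negP/indep.
  split=> //; move/eqP: yE; rewrite be_b subrr scale0r scalemx_eq0 map_mx_eq0.
  by rewrite (negPf nz_y0) orbF subr_eq0 => /eqP->.
have [xE yE] : x = f a *: x0 /\ y = a *: y0 + b *: y1.
  by move: eE; rewrite aE bE fw => /emb_inj[].
have b0 : b = 0 by apply: (y1P a); rewrite -yE.
apply/eq_genmx; rewrite eE bE b0 rmorph0 scale0r addr0; apply: eqmx_scale.
by apply: contra_neq nz_xy => al0; rewrite eE bE b0 rmorph0 scale0r addr0 al0 scale0r.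
Qed.

(** A proper subset omits some cone point, and a subspace meeting the cone only in that point is
    then unblocked. *)
Lemma cone_points_minimal (k : nat) : k = (N - d.+1)%N ->
    blocking_set 1 Bbar ->
    (forall P, P \in Bbar -> (0 < #|tangent_lines_through Bbar P|)%N) ->
  minimal_blocking_set k.-1 cone_points.
Proof.
move=> kE blockB tanB; split=> [|B' /properP[sB' [P]]].
  exact: cone_points_blocking.
case/imsetP=> u Cu -> PB' [_ blockB'].
have [U Uk onlyP] := cone_points_essential kE blockB tanB Cu.
have [|Q BQ QU] := blockB' U; first by rewrite prednK // kE addKn.
by case/negP: PB'; rewrite -(onlyP Q) // (subsetP sB').
Qed.

End Cone.

(* F plays the role of GF(q), K the role of GF(q^t) (unique up to
   isomorphism); q := #|F| is then automatically a prime power. *)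
Theorem theorem4p8 (F K : finFieldType) (n k t : nat)
    (Bbar : {set 'M[F]_3}) :
  (0 < n)%N -> (0 < k)%N -> (0 < t)%N -> (k < n)%N -> (n + 3 <= 2 * k)%N ->
  #|K| = (#|F| ^ t)%N ->
  @minimal_blocking_set F 3 1 Bbar ->
  (forall P, P \in Bbar -> (2 <= #|tangent_lines_through Bbar P|)%N) ->
  exists B : {set 'M[K]_n},
    @minimal_blocking_set K n k.-1 B /\
    #|B| = (#|Bbar| * #|F| ^ (n * t - k * t - 1)
            + (#|F| ^ (n * t - k * t - 1) - 1) %/ (#|F| - 1))%N.
Proof.
move=> _ _ t_gt0 ltkn le_nk cardK [blockB _] tanB.
have [subB _] := blockB; have [f] := finField_embedding cardK.
have [d dE] : exists d, (n - k = d.+1)%N.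
  by exists (n - k).-1; rewrite prednK ?subn_gt0.
(* The bound n + 3 <= 2k says 2(n - k) + 3 <= n; [r] is the slack. *)
have [r nE] : exists r, n = (d.+1 + (d.+1 + (3 + r)))%N.
  by exists (n - (d.+1 + (d.+1 + 3)))%N; lia.
have kE : k = (n - d.+1)%N by rewrite -dE subKn // ltnW.
rewrite -mulnBl dE; clear dE; subst n.
exists (cone_points f d r Bbar); split.
  by apply: cone_points_minimal => // P BP; apply: ltnW (tanB P BP).
suff <- : #|hyper F K d| = (#|F| ^ (d.+1 * t - 1))%N.
  exact: card_cone_points_eq.
have q_gt0 : (0 < #|F|)%N := ltnW (finNzRing_gt1 F).
(* |H| q = |K|^(d+1) = q^((d+1)t), whence the exponent (n - k)t - 1. *)
apply/eqP; rewrite -(eqn_pmul2r q_gt0) card_hyper // cardK -expnM mulnC -expnSr.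
by rewrite subn1 prednK // muln_gt0.
Qed.
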